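(* Let $\mathcal{T}\subset\mathbb{R}$ be measurable with positive finite measure $T=|\mathcal{T}|$ and finite essential diameter $D=\operatorname{diam}_{\mathrm{ess}}(\mathcal{T})$. Let $\xi\in\mathbb{R}$. If $|\xi|D\le 1$, then $$|\widehat{\mathbf{1}_{\mathcal{T}}}(\xi)|\le\begin{cases}\dfrac{\sin(\pi|\xi|T)}{\pi|\xi|}&\text{if }\xi\neq0,\\[2mm] T&\text{if }\xi=0.\end{cases}$$ Equivalently, for $I_T=[-T/2,T/2]$, $|\widehat{\mathbf{1}_{\mathcal{T}}}(\xi)|\le\widehat{\mathbf{1}_{I_T}}(\xi)$.
   Context: The Fourier transform is $\widehat f(\xi)=\int_{\mathbb{R}}f(t)e^{-2\pi i\xi t}\,dt$, and $\mathbf{1}_{\mathcal{T}}$ is the indicator function of $\mathcal{T}$. $|\mathcal{T}|$ denotes Lebesgue measure. The essential diameter of a measurable set $\mathcal{T}\subset\mathbb{R}$ is $\operatorname{diam}_{\mathrm{ess}}(\mathcal{T})=\operatorname{ess\,sup}\mathcal{T}-\operatorname{ess\,inf}\mathcal{T}\in[0,\infty]$, where $\operatorname{ess\,sup}\mathcal{T}$ and $\operatorname{ess\,inf}\mathcal{T}$ are the essential supremum and infimum of the identity function on $\mathcal{T}$. *)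

(* Defs.v *)
From HB Require Import structures.
From mathcomp Require Import all_boot all_order all_algebra.
From mathcomp Require Import complex.
From mathcomp Require Import all_classical all_reals all_analysis.
From mathcomp Require Import ess_sup_inf.

Set Implicit Arguments.
Unset Strict Implicit.
Unset Printing Implicit Defensive.

Import Order.TTheory GRing.Theory Num.Theory.
Import numFieldNormedType.Exports.

Local Open Scope classical_set_scope.
Local Open Scope ring_scope.
Local Open Scope complex_scope.

(* The line [R] with the sigma-algebra of Lebesgue (= Caratheodory) measurable
   sets, on which [completed_lebesgue_measure] is a measure; the library's
   default sigma-algebra on [R] is the smaller Borel one. *)
Notation lebesgueR R := (caratheodory_type (wlength (R := R) idfun)^*%mu).

Definition leb {R : realType} : {measure set (lebesgueR R) -> \bar R} :=
  @completed_lebesgue_measure R.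

Definition Cintegral d (X : measurableType d) (R : realType)
    (mu : {measure set X -> \bar R}) (f : X -> R[i]) : R[i] :=
  (\int[mu]_t complex.Re (f t)) +i* (\int[mu]_t complex.Im (f t)).

(* e^(i x) for real x *)
Definition expi (R : realType) (x : R) : R[i] := cos x +i* sin x.

(* As for the library's integral, this is only meaningful when f is integrable. *)
Definition fourier (R : realType) (f : R -> R[i]) (xi : R) : R[i] :=
  Cintegral leb (fun t : lebesgueR R => f t * expi (- (2 * pi * xi * t))).

Definition cindic (R : realType) (S : set R) (t : R) : R[i] := (\1_S t)%:C.

(* Essential supremum minus essential infimum of the identity on S, i.e. with
   respect to the restriction of Lebesgue measure to S. For |S| > 0 this is
   never an indeterminate difference of infinities. *)
Definition diam_ess (R : realType) (S : set (lebesgueR R))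
    (mS : measurable S) : \bar R :=
  (ess_sup (mrestr leb mS) (fun t : lebesgueR R => (t : R)%:E)
   - ess_inf (mrestr leb mS) (fun t : lebesgueR R => (t : R)%:E))%E.

(* Main.v *)
Require Import Defs.
From mathcomp Require Import all_boot all_order all_algebra.
From mathcomp Require Import complex.
From mathcomp Require Import all_classical all_reals all_analysis.
From mathcomp Require Import ess_sup_inf measurable_realfun.
From mathcomp Require Import ring lra.

Set Implicit Arguments.
Unset Strict Implicit.
Unset Printing Implicit Defensive.

Import Order.TTheory GRing.Theory Num.Theory.
Import numFieldNormedType.Exports.
Local Open Scope classical_set_scope.
Local Open Scope ring_scope.
Local Open Scope complex_scope.

(** The modulus of the transform is attained at some phase: for a suitable
    [phi] it equals the integral over [S] of [cos (w t - phi)], where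
    [w = 2 pi |xi|] ([polar_phase], [normc_fourier_phase]).  Up to a null set,
    [S] lies in an interval of length [D] ([diam_ess_window]), and the
    hypothesis [|xi| D <= 1] says that this interval is no longer than the
    period [1 / |xi|] of that cosine.  Hence on the window the cosine has, up to
    periodicity, a single bump, and among all subsets of the window of
    measure [T] the integral is largest on the superlevel set, the points
    within [T / 2] of the peak modulo the period ([bathtub], applied in
    [integral_cos_le]).  The integral over that set is that of [cos (w t)] over
    [[- T / 2, T / 2]], which is the claimed value and also the transform of the
    indicator of that interval ([fourier_itv]).

    The peak may sit anywhere in the window, so the superlevel set is either
    an interval or two intervals touching the ends of the window; this is why
    the bathtub inequality compares [S] with two sets. *)

(** * Cosines and phases *)

(** Within one period, the cosine is below [cos al] off the arc of half-width
    [al] around the peak; [cos_ge_inside] is the converse on the arc. Together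
    they identify the superlevel set that the rearrangement needs. *)
Lemma cos_le_outside (R : realType) (al x : R) : 0 <= al ->
  al <= x <= 2 * pi - al -> cos x <= cos al.
Proof.
move=> al0 /andP[alx xal].
have pi0 := @pi_gt0 R.
have key (y : R) : al <= y -> y <= pi -> cos y <= cos al.
  move=> aly ypi; have [->//|nay] := eqVneq y al.
  rewrite ltW// ltr_cos ?in_itv/=; [lra| |]; apply/andP; split; lra.
have [xpi|xpi] := leP x pi; first exact: key.
have -> : cos x = cos (2 * pi - x).
  by rewrite -[RHS]cosN -[in RHS]cosD2pi; congr cos; rewrite -mulr_natl; lra.
apply: key; lra.
Qed.

Lemma cos_ge_inside (R : realType) (al x : R) : al <= pi ->
  `|x| <= al -> cos al <= cos x.
Proof.
move=> alpi xal; rewrite -(cos_norm x).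
by apply: cos_le_outside => //; lra.
Qed.

Lemma cosB2pi (R : realType) (x : R) : cos (x - 2 * pi) = cos x.
Proof. by rewrite -(cosD2pi (x - 2 * pi)); congr cos; ring. Qed.

Lemma sinB2pi (R : realType) (x : R) : sin (x - 2 * pi) = sin x.
Proof. by rewrite -(sinD2pi (x - 2 * pi)); congr sin; ring. Qed.

Lemma cosDint2pi (R : realType) (k : int) (x : R) :
  cos (x + k%:~R * (2 * pi)) = cos x.
Proof.
have nat_case (n : nat) (y : R) : cos (y + n%:R * (2 * pi)) = cos y.
  rewrite -[RHS](periodicn (@cosD2pi R) n); congr cos; ring.
case: k => n; first exact: nat_case.
by rewrite NegzE mulrNz mulNr -(nat_case n.+1 (x - _)) subrK.
Qed.

(** The phase matters only modulo [2 pi], so the peak of the cosine can be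
    placed wherever the window of the set makes it convenient. *)
Lemma phase_in_window (R : realType) (phi l : R) :
  exists psi : R, l <= psi < l + 2 * pi /\
    forall x, cos (x - phi) = cos (x - psi).
Proof.
have pi0 : 0 < 2 * pi :> R by rewrite mulr_gt0// pi_gt0.
pose k := Num.floor ((phi - l) / (2 * pi)).
exists (phi - k%:~R * (2 * pi)); split.
  have /andP[] := floor_itv ((phi - l) / (2 * pi)).
  rewrite -/k ler_pdivlMr// ltr_pdivrMr// intrD mulrDl mul1r => ? ?.
  apply/andP; split; lra.
by move=> x; rewrite -(cosDint2pi k (x - phi)); congr cos; ring.
Qed.

(** A polar form of [x + i y]: rotating by [- phi] makes the number real and
    nonnegative, with real part on the left. *)
Lemma polar_phase (R : realType) (x y : R) :
  exists phi : R, x * cos phi + y * sin phi = Num.sqrt (x ^+ 2 + y ^+ 2).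
Proof.
set r := Num.sqrt _.
have r2 : r ^+ 2 = x ^+ 2 + y ^+ 2 by rewrite sqr_sqrtr// addr_ge0 ?sqr_ge0.
have r0 : 0 <= r by exact: sqrtr_ge0.
have [req0|rneq0] := eqVneq r 0.
  exists 0; move: r2; rewrite req0 expr0n/= => /esym/eqP.
  rewrite paddr_eq0 ?sqr_ge0// !sqrf_eq0 => /andP[/eqP-> /eqP->].
  by rewrite !mul0r addr0.
have rgt0 : 0 < r by rewrite lt_def rneq0.
have x2 : x ^+ 2 <= r ^+ 2 by rewrite r2 lerDl sqr_ge0.
have xr : -1 <= x / r <= 1.
  rewrite -ler_norml normrM normfV (ger0_norm r0) ler_pdivrMr// mul1r.
  by rewrite -(ger0_norm r0) -ler_sqr ?nnegrE// !real_normK ?num_real.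
have sinE : sin (acos (x / r)) = `|y| / r.
  rewrite sin_acos// -[RHS]ger0_norm ?divr_ge0//.
  rewrite -sqrtr_sqr; congr Num.sqrt; rewrite !exprMn real_normK ?num_real//.
  have -> : y ^+ 2 = r ^+ 2 - x ^+ 2 by rewrite r2; ring.
  by field.
have fin : x * (x / r) + y * (y / r) = r.
  apply: (mulIf rneq0); rewrite -[RHS]expr2 r2; by field.
(* [acos] only sees the upper half plane; the lower one is its mirror image. *)
have [y0|y0] := leP 0 y.
  by exists (acos (x / r)); rewrite acosK ?in_itv// sinE ger0_norm.
exists (- acos (x / r)); rewrite cosN sinN acosK ?in_itv// sinE ltr0_norm//.
by rewrite mulNr opprK.
Qed.

(** * The bathtub inequality *)

(** Subtracting the level [c] costs the same on both sides, since the measures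
    agree; afterwards [f - c] is nonnegative on [J] and [K] and nonpositive on
    the rest of [S], so the inequality holds pointwise between the restricted
    functions. The sets [J] and [K] may overlap, as the overlap only enlarges
    the right-hand side after subtraction. *)
Lemma bathtub d (X : measurableType d) (R : realType)
    (mu : {measure set X -> \bar R}) (S J K : set X) (f : X -> R) (c : R) :
  measurable S -> measurable J -> measurable K ->
  (mu S < +oo)%E -> mu S = (mu J + mu K)%E ->
  mu.-integrable S (EFin \o f) -> mu.-integrable J (EFin \o f) ->
  mu.-integrable K (EFin \o f) ->
  (forall x, J x \/ K x -> c <= f x) ->
  (forall x, S x -> ~ J x -> ~ K x -> f x <= c) ->
  \int[mu]_(x in S) f x <= \int[mu]_(x in J) f x + \int[mu]_(x in K) f x.
Proof.
move=> mS mJ mK Soo SJK fS fJ fK fJKc fSc.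
have Joo : (mu J < +oo)%E.
  by rewrite (le_lt_trans _ Soo)// SJK leeDl.
have Koo : (mu K < +oo)%E.
  by rewrite (le_lt_trans _ Soo)// SJK leeDr.
have cI A : measurable A -> (mu A < +oo)%E -> mu.-integrable A (EFin \o cst c).
  move=> mA Aoo; apply: measurable_bounded_integrable => //.
  exact: bounded_cst.
have gI A : measurable A -> (mu A < +oo)%E -> mu.-integrable A (EFin \o f) ->
    mu.-integrable A (EFin \o (fun x => f x - c)).
  by move=> mA Aoo fA; apply: (integrableB mA fA (cI _ mA Aoo)).
have gE A : measurable A -> (mu A < +oo)%E -> mu.-integrable A (EFin \o f) ->
    \int[mu]_(x in A) (f x - c) = \int[mu]_(x in A) f x - c * fine (mu A).
  move=> mA Aoo fA; rewrite RintegralB//; last exact: cI.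
  by rewrite Rintegral_cst.
have gT A : measurable A -> (mu A < +oo)%E -> mu.-integrable A (EFin \o f) ->
    mu.-integrable setT (EFin \o ((fun x => f x - c) \_ A)).
  by move=> mA Aoo fA; rewrite -restrict_EFin -integrable_mkcond//; exact: gI.
have main : \int[mu]_(x in S) (f x - c) <=
    \int[mu]_(x in J) (f x - c) + \int[mu]_(x in K) (f x - c).
  rewrite !(Rintegral_mkcond _ _ (fun x => f x - c)) -RintegralD//; [|exact: gT..].
  apply: le_Rintegral => //; first exact: gT.
    exact: (integrableD measurableT (gT _ mJ Joo fJ) (gT _ mK Koo fK)).
  (* Restrictions extend functions by the default point of the codomain. *)
  have pt0 : point = 0 :> R by [].
  move=> x _; rewrite !patchE.
  have [xJ|xJ] := boolP (x \in J); have [xK|xK] := boolP (x \in K);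
    have [xS|xS] := boolP (x \in S);
    rewrite ?pt0 ?addr0 ?add0r//.
  - have := fJKc x (or_introl (set_mem xJ)); lra.
  - have := fJKc x (or_introl (set_mem xJ)); lra.
  - have := fJKc x (or_introl (set_mem xJ)); lra.
  - have := fJKc x (or_intror (set_mem xK)); lra.
  - rewrite subr_le0; apply: fSc; first exact: set_mem.
      by move/mem_set; rewrite (negbTE xJ).
    by move/mem_set; rewrite (negbTE xK).
move: main; rewrite !gE// SJK fineD ?ge0_fin_numE//; lra.
Qed.

(** * Lebesgue-measurable sets and the fundamental theorem *)

Lemma measurable_leb (R : realType) (A : set R) :
  measurable (A : set (measurableTypeR R)) ->
  measurable (A : set (lebesgueR R)).
Proof. by move=> mA; exact: sub_caratheodory. Qed.

Lemma measurable_id_leb (R : realType) :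
  measurable_fun [set: lebesgueR R] (id : lebesgueR R -> measurableTypeR R).
Proof. by move=> _ A mA; rewrite setTI; exact: measurable_leb. Qed.

Lemma measurable_leb_itv (R : realType) (i : interval R) :
  measurable ([set` i] : set (lebesgueR R)).
Proof. by apply: measurable_leb; exact: measurable_itv. Qed.

Lemma leb_itv (R : realType) (u v : R) : u <= v ->
  leb (`[u, v]%classic : set (lebesgueR R)) = (v - u)%:E.
Proof.
move=> uv; transitivity (lebesgue_measure `[u, v]%classic) => //.
rewrite lebesgue_measure_itv/= lte_fin; case: ltP => // vu.
by rewrite (@le_anti _ R u v) ?subrr// uv vu.
Qed.

(** Lebesgue measure on Borel sets is the image of its completion under the
    identity; this transfers integrals to the Borel line, where the fundamental
    theorem of calculus is stated. *)
Lemma Rintegral_leb (R : realType) (A : set R) (f : R -> R) :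
  measurable (A : set (measurableTypeR R)) ->
  measurable_fun [set: measurableTypeR R] f ->
  leb.-integrable (A : set (lebesgueR R)) (EFin \o f) ->
  \int[leb]_(t in (A : set (lebesgueR R))) f t =
  \int[lebesgue_measure]_(t in A) f t.
Proof.
move=> mA mf fA; rewrite /Rintegral; congr fine.
have /measurable_EFinP mEf := mf.
have := @integral_pushforward _ _ _ _ R _ (@measurable_id_leb R) leb A _ mEf fA mA.
by move=> /= <-.
Qed.

Lemma measurable_cos_leb (R : realType) (A : set (lebesgueR R)) (w phi : R) :
  measurable_fun A (fun t : lebesgueR R => cos (w * t - phi)).
Proof.
apply: measurable_funTS.
have m : measurable_fun [set: measurableTypeR R]
    (fun t : R => cos (w * t - phi)).
  apply: continuous_measurable_fun => x.
  apply: continuous_comp; last exact: continuous_cos.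
  by apply: cvgB; [apply: cvgM => //; exact: cvg_cst|exact: cvg_cst].
exact: (measurableT_comp m (@measurable_id_leb R)).
Qed.

Lemma integrable_cos (R : realType) (A : set (lebesgueR R)) (w phi : R) :
  measurable A -> (leb A < +oo)%E ->
  leb.-integrable A (EFin \o (fun t : lebesgueR R => cos (w * t - phi))).
Proof.
move=> mA Aoo; apply: measurable_bounded_integrable => //.
  exact: measurable_cos_leb.
exists 1; split => // M M1 x _ /=.
exact: le_trans (cos_max _) (ltW M1).
Qed.

Lemma integral_cos_itv (R : realType) (w phi u v : R) : w != 0 -> u <= v ->
  \int[leb]_(t in (`[u, v]%classic : set (lebesgueR R))) cos (w * t - phi)
  = (sin (w * v - phi) - sin (w * u - phi)) / w.
Proof.
move=> w0 uv.
have itvoo : (leb (`[u, v]%classic : set (lebesgueR R)) < +oo)%E.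
  by rewrite leb_itv// ltry.
have cc : continuous (fun t : R => cos (w * t - phi)).
  move=> x; apply: continuous_comp; last exact: continuous_cos.
  by apply: cvgB; [apply: cvgM => //; exact: cvg_cst|exact: cvg_cst].
rewrite Rintegral_leb//; first last.
- apply: integrable_cos => //; exact: measurable_leb_itv.
- exact: continuous_measurable_fun.
move: uv; rewrite le_eqVlt => /predU1P[<-|uv].
  by rewrite set_itv1 Rintegral_set1 subrr mul0r.
pose F (t : R) := sin (w * t - phi) / w.
have dF (x : R) : is_derive x 1 F (cos (w * x - phi)).
  rewrite /F; apply: is_derive_eq.
  rewrite /GRing.scale /=; field.
  exact: w0.
have cF : continuous F.
  by move=> x; apply/differentiable_continuous/derivable1_diffP; case: (dF x).
rewrite /Rintegral (@continuous_FTC2 _ _ F)//.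
- by rewrite /= /F -mulrBl.
- exact: continuous_subspaceT.
- split; first by move=> x _; case: (dF x).
  + by apply: cvg_at_right_filter; exact: cF.
  + by apply: cvg_at_left_filter; exact: cF.
- by move=> x _; rewrite derive1E; case: (dF x).
Qed.

(** * Maximising the integral of a cosine over one period *)

(** The bathtub inequality at the level [cos (w T / 2)]. The right-hand side is
    the integral of the bump of width [T] around a peak; it does not depend
    on [a] or [phi]. *)
Lemma integral_cos_le (R : realType) (S : set (lebesgueR R)) (T w a phi : R) :
  measurable S -> 0 < w -> leb S = T%:E ->
  S `<=` `[a, a + 2 * pi / w]%classic ->
  \int[leb]_(t in S) cos (w * t - phi) <= 2 * sin (w * (T / 2)) / w.
Proof.
move=> mS w0 ST SW.
have wn0 : w != 0 by rewrite gt_eqF.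
pose P := 2 * pi / w; pose s := T / 2.
have wP : w * P = 2 * pi by rewrite /P mulrC divfK.
have pi0 := @pi_gt0 R.
have P0 : 0 < P by rewrite divr_gt0// mulr_gt0.
have T0 : 0 <= T by rewrite -lee_fin -ST.
have TP : T <= P.
  rewrite -lee_fin -ST.
  have <- : leb (`[a, a + P]%classic : set (lebesgueR R)) = P%:E.
    by rewrite leb_itv ?lerDl ?(ltW P0)// addrAC subrr add0r.
  by apply: le_measure; rewrite ?inE//; exact: measurable_leb_itv.
have ws0 : 0 <= w * s by rewrite mulr_ge0 ?(ltW w0)// divr_ge0.
have wspi : w * s <= pi.
  have : w * s <= w * (P / 2) by rewrite ler_pM2l// ler_pM2r.
  by rewrite mulrA wP; lra.
(* This choice of the phase puts the left end [p - s] of the bump around the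
   peak [p = psi / w] before [a], but by at most one period, so the next bump,
   around [p + P], starts inside the window and only its right end may stick
   out. *)
have [psi [/andP[psi1 psi2] psiE]] := phase_in_window phi (w * a - 2 * pi + w * s).
pose p := psi / w.
have wp : w * p = psi by rewrite /p mulrC divfK.
rewrite (@eq_Rintegral _ _ _ _ _
  (fun t : lebesgueR R => cos (w * t - psi))); last first.
  by move=> t _; rewrite psiE.
have lew (x y : R) : x <= y -> w * x <= w * y by rewrite ler_pM2l.
have inW (t : R) : S t -> a <= t <= a + P.
  by move/SW; rewrite /= in_itv.
have intv (u v : R) : u <= v ->
    leb.-integrable (`[u, v]%classic : set (lebesgueR R))
      (EFin \o (fun t : lebesgueR R => cos (w * t - psi))).
  move=> uv; apply: integrable_cos; first exact: measurable_leb_itv.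
  by rewrite leb_itv// ltry.
have intS : leb.-integrable S
    (EFin \o (fun t : lebesgueR R => cos (w * t - psi))).
  by apply: integrable_cos => //; rewrite ST ltry.
have outside (t : R) : w * s <= w * t - psi <= 2 * pi - w * s ->
    cos (w * t - psi) <= cos (w * s).
  exact: cos_le_outside.
have inside (t : R) : `|w * t - psi| <= w * s -> cos (w * s) <= cos (w * t - psi).
  exact: cos_ge_inside.
have inside' (t : R) : `|w * t - psi - 2 * pi| <= w * s ->
    cos (w * s) <= cos (w * t - psi).
  by rewrite -(cosB2pi (w * t - psi)); exact: cos_ge_inside.
have pa : p - s < a by rewrite -(ltr_pM2l w0) mulrBr wp; lra.
have pP : a + s <= p + P by rewrite -(ler_pM2l w0) !mulrDr wp wP; lra.
have [aps|psa] := leP a (p + s).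
(* The bump around [p] reaches into the window, and by the same amount the
   next one sticks out on the right: the two visible pieces make up one bump. *)
- have aps2 : p + P - s <= a + P by lra.
  have := lew _ _ aps; rewrite mulrDr wp => waps.
  pose J : set (lebesgueR R) := `[a, p + s]%classic.
  pose K : set (lebesgueR R) := `[p + P - s, a + P]%classic.
  apply: (@le_trans _ _ (\int[leb]_(t in J) cos (w * t - psi) +
      \int[leb]_(t in K) cos (w * t - psi))).
    apply: (@bathtub _ _ _ _ _ _ _ _ (cos (w * s))) => //.
    + exact: measurable_leb_itv.
    + exact: measurable_leb_itv.
    + by rewrite ST ltry.
    + by rewrite ST !leb_itv// -EFinD /s; congr EFin; field.
    + exact: intv.
    + exact: intv.
    + move=> t [|]; rewrite /J /K /= in_itv/= => /andP[/lew t1 /lew t2].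
        by apply: inside; rewrite ler_norml; apply/andP; split; lra.
      by apply: inside'; rewrite ler_norml; apply/andP; split; lra.
    + move=> t /inW/andP[t1 t2] Jt Kt; apply: outside.
      have /lew t3 : p + s <= t.
        by rewrite leNgt; apply/negP => t3; apply: Jt; rewrite /J/= in_itv/= t1 ltW.
      have /lew t4 : t <= p + P - s.
        by rewrite leNgt; apply/negP => t4; apply: Kt; rewrite /K/= in_itv/= t2 ltW.
      apply/andP; split; lra.
  rewrite !integral_cos_itv// -mulrDl ler_pM2r ?invr_gt0//.
  have -> : w * (p + s) - psi = w * s by lra.
  have -> : w * (a + P) - psi = (w * a - psi) + 2 * pi by lra.
  have -> : w * (p + P - s) - psi = - (w * s) + 2 * pi by lra.
  rewrite -[sin (w * a - psi + _)]sinB2pi addrK.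
  rewrite -[sin (- (w * s) + _)]sinB2pi addrK sinN /s; lra.
(* The bump around [p + P] lies entirely inside the window. *)
- have := psa; rewrite -(ltr_pM2l w0) mulrDr wp => wpsa.
  pose J : set (lebesgueR R) := `[p + P - s, p + P + s]%classic.
  have Jle : p + P - s <= p + P + s by rewrite /s; lra.
  apply: (@le_trans _ _ (\int[leb]_(t in J) cos (w * t - psi) +
      \int[leb]_(t in (set0 : set (lebesgueR R))) cos (w * t - psi))).
    apply: (@bathtub _ _ _ _ _ _ _ _ (cos (w * s))) => //.
    + exact: measurable_leb_itv.
    + by rewrite ST ltry.
    + by rewrite measure0 adde0 ST !leb_itv// /s; congr EFin; field.
    + exact: intv.
    + by apply: integrable_cos => //; rewrite measure0.
    + move=> t [|//]; rewrite /J /= in_itv/= => /andP[/lew t1 /lew t2].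
      by apply: inside'; rewrite ler_norml; apply/andP; split; lra.
    + move=> t /inW/andP[/lew t1 /lew t2] Jt _.
      have [t3|t3] := ltP t (p + P - s).
        by apply: outside; have := lew _ _ (ltW t3) => ?; apply/andP; split; lra.
      have /lew t4 : p + P + s <= t.
        by rewrite leNgt; apply/negP => t4; apply: Jt; rewrite /J/= in_itv/= t3 ltW.
      rewrite -(cosB2pi (w * t - psi)).
      apply: cos_le_outside => //; apply/andP; split; lra.
  rewrite Rintegral_set0 addr0 integral_cos_itv// ler_pM2r ?invr_gt0//.
  have -> : w * (p + P + s) - psi = w * s + 2 * pi by lra.
  have -> : w * (p + P - s) - psi = - (w * s) + 2 * pi by lra.
  rewrite -[sin (w * s + _)]sinB2pi addrK.
  rewrite -[sin (- (w * s) + _)]sinB2pi addrK sinN /s; lra.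
Qed.

(** * The transform of an indicator function *)

Lemma Rintegral_setI_ae d (X : measurableType d) (R : realType)
    (mu : {measure set X -> \bar R}) (S W : set X) (f : X -> R) :
  measurable S -> measurable W -> mu (S `\` W) = 0%E ->
  mu.-integrable S (EFin \o f) ->
  \int[mu]_(x in S) f x = \int[mu]_(x in S `&` W) f x.
Proof.
move=> mS mW SW0 fS; rewrite /Rintegral; congr fine.
rewrite (@negligible_integral _ _ _ _ _ (S `\` W))//; last exact: measurableD.
by rewrite setDD.
Qed.

(** Both essential bounds are finite because their difference is: in the
    extended reals an indeterminate or infinite difference is never real. The
    window starts at the essential infimum. *)
Lemma diam_ess_window (R : realType) (S : set (lebesgueR R))
    (mS : measurable S) (D : R) : diam_ess mS = D%:E ->
  exists a : R, leb (S `\` `[a, a + D]%classic) = 0%E.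
Proof.
rewrite /diam_ess; set M := ess_sup _ _; set m := ess_inf _ _ => MmD.
have Mge := ess_sup_ge (mrestr leb mS) (fun t : lebesgueR R => (t : R)%:E).
have mle := ess_inf_le (mrestr leb mS) (fun t : lebesgueR R => (t : R)%:E).
rewrite -/M in Mge; rewrite -/m in mle.
move: m M MmD Mge mle => [m| |] [M| |]//= [MmD] Mge mle.
exists m.
have [N [mN N0 subN]] := filterI Mge mle.
apply: (@subset_measure0 _ _ _ _ _ (N `&` S)) => //.
- by apply: measurableD => //; exact: measurable_leb_itv.
- exact: measurableI.
- move=> t [St Wt]; split => //; apply: subN => /= -[]; rewrite !lee_fin => tM mt.
  by apply: Wt; rewrite /= in_itv/= mt/= (_ : m + D = M)// -MmD; ring.
Qed.

Lemma fourier_cindic (R : realType) (S : set (lebesgueR R)) (xi : R) :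
  fourier (cindic S) xi =
  (\int[leb]_(t in S) cos (- (2 * pi * xi * t))) +i*
  (\int[leb]_(t in S) sin (- (2 * pi * xi * t))).
Proof.
rewrite /fourier /Cintegral; congr (_ +i* _);
  rewrite [RHS]Rintegral_mkcond; apply: eq_Rintegral => t _;
  rewrite patch_indic /cindic /expi /= mul0r ?subr0 ?addr0 mulrC//.
Qed.

(** Rotating the transform by its argument turns its modulus into a single
    real integral. The frequency can be taken nonnegative because the cosine
    is even, at the price of changing the sign of the phase. *)
Lemma normc_fourier_phase (R : realType) (S : set (lebesgueR R)) (xi : R) :
  measurable S -> (leb S < +oo)%E ->
  exists phi : R, `|fourier (cindic S) xi| =
    (\int[leb]_(t in S) cos (2 * pi * `|xi| * t - phi))%:C.
Proof.
move=> mS Soo; rewrite fourier_cindic normc_def /=.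
set x := Rintegral _ _ _; set y := Rintegral _ _ _.
have [phi <-] := polar_phase x y.
have ic := integrable_cos (- (2 * pi * xi)) 0 mS Soo.
have isn := integrable_cos (- (2 * pi * xi)) (pi / 2) mS Soo.
have xE : x = \int[leb]_(t in S) cos (- (2 * pi * xi) * t - 0).
  by apply: eq_Rintegral => t _; rewrite subr0 mulNr.
have yE : y = \int[leb]_(t in S) cos (- (2 * pi * xi) * t - pi / 2).
  by apply: eq_Rintegral => t _; rewrite cosBpihalf mulNr.
have E : x * cos phi + y * sin phi =
    \int[leb]_(t in S) cos (- (2 * pi * xi) * t - phi).
  rewrite xE yE -!RintegralZr// -RintegralD//.
  - by apply: eq_Rintegral => t _; rewrite subr0 cosBpihalf cosB.
  - by have := integrableZr mS (cos phi) ic.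
  - by have := integrableZr mS (sin phi) isn.
exists (if 0 <= xi then - phi else phi).
rewrite E; congr (_%:C); apply: eq_Rintegral => t _.
have [xi0|xi0] := leP 0 xi; last first.
  by rewrite ltr0_norm//; congr cos; ring.
by rewrite ger0_norm// -cosN; congr cos; ring.
Qed.

(** The sine part vanishes by symmetry of the interval, so the transform
    is real and can be compared with a modulus in the order of the complex
    numbers. *)
Lemma fourier_itv (R : realType) (T xi : R) : 0 < T ->
  fourier (cindic `[- (T / 2), T / 2]) xi =
  (if xi == 0 then T else sin (pi * `|xi| * T) / (pi * `|xi|))%:C.
Proof.
move=> T0; have TT : - (T / 2) <= T / 2 by lra.
rewrite fourier_cindic; case: eqVneq => [->|xi0].
  congr (_ +i* _).
    rewrite (@eq_Rintegral _ _ _ _ _ (fun=> 1)); last first.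
      by move=> t _; rewrite mulr0 mul0r oppr0 cos0.
    rewrite Rintegral_cst; last exact: measurable_leb_itv.
    by rewrite leb_itv//= mul1r; field.
  rewrite (@eq_Rintegral _ _ _ _ _ (fun=> 0)); last first.
    by move=> t _; rewrite mulr0 mul0r oppr0 sin0.
  by rewrite Rintegral_cst ?mul0r//; exact: measurable_leb_itv.
have pi0 : pi != 0 :> R by rewrite gt_eqF// pi_gt0.
have w0 : - (2 * pi * xi) != 0 by rewrite oppr_eq0 !mulf_neq0.
congr (_ +i* _).
  rewrite (@eq_Rintegral _ _ _ _ _
    (fun t : lebesgueR R => cos (- (2 * pi * xi) * t - 0))); last first.
    by move=> t _; rewrite subr0 mulNr.
  rewrite integral_cos_itv// !subr0.
  move: (@pi R) pi0 {w0} => p p0.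
  have -> : - (2 * p * xi) * - (T / 2) = p * xi * T by field.
  have -> : - (2 * p * xi) * (T / 2) = - (p * xi * T) by field.
  have [xp|xn] := leP 0 xi.
    rewrite ger0_norm// sinN; field.
    by rewrite xi0 p0.
  rewrite ltr0_norm// mulrN mulNr !sinN; field.
  by rewrite xi0 p0.
rewrite (@eq_Rintegral _ _ _ _ _
  (fun t : lebesgueR R => cos (- (2 * pi * xi) * t - pi / 2))); last first.
  by move=> t _; rewrite cosBpihalf mulNr.
rewrite integral_cos_itv// !sinBpihalf.
by rewrite mulrN cosN subrr mul0r.
Qed.

Lemma normc_fourier_le (R : realType) (S : set (lebesgueR R))
    (mS : measurable S) (T D xi : R) :
  leb S = T%:E -> diam_ess mS = D%:E -> `|xi| * D <= 1 ->
  `|fourier (cindic S) xi|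
     <= (if xi == 0 then T else sin (pi * `|xi| * T) / (pi * `|xi|))%:C.
Proof.
move=> ST SD xiD.
have Soo : (leb S < +oo)%E by rewrite ST ltry.
have [phi ->] := normc_fourier_phase xi mS Soo.
rewrite lecR; case: eqVneq => [->|xi0].
  (* At frequency zero the integrand is constant, and at most one. *)
  rewrite (@eq_Rintegral _ _ _ _ _ (fun=> cos (- phi))); last first.
    by move=> t _; rewrite normr0 mulr0 mul0r add0r.
  rewrite Rintegral_cst// ST/=.
  by rewrite -[leRHS]mul1r ler_wpM2r ?cos_le1// -lee_fin -ST.
have nxi0 : 0 < `|xi| by rewrite normr_gt0.
have w0 : 0 < 2 * pi * `|xi| by rewrite !mulr_gt0// pi_gt0.
have pin0 : pi != 0 :> R by rewrite gt_eqF// pi_gt0.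
have nxin0 : `|xi| != 0 by rewrite gt_eqF.
have [a SW0] := diam_ess_window SD.
pose W : set (lebesgueR R) := `[a, a + 2 * pi / (2 * pi * `|xi|)]%classic.
have mW : measurable W by exact: measurable_leb_itv.
have SW : leb (S `\` W) = 0%E.
  apply: (subset_measure0 _ _ _ SW0).
  - exact: measurableD.
  - by apply: measurableD => //; exact: measurable_leb_itv.
  - apply: setDS; apply: subset_itvl; rewrite bnd_simp lerD2l.
    rewrite invfM mulrA divff ?mul1r ?mulf_neq0//.
    by rewrite -(ler_pM2l nxi0) divff.
rewrite (Rintegral_setI_ae mS mW SW); last exact: integrable_cos.
have -> : sin (pi * `|xi| * T) / (pi * `|xi|) =
    2 * sin (2 * pi * `|xi| * (T / 2)) / (2 * pi * `|xi|).
  rewrite (_ : 2 * pi * `|xi| * (T / 2) = pi * `|xi| * T); last by field.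
  by rewrite -(mulrA 2 pi) -mulf_div divff ?mul1r.
apply: (@integral_cos_le _ _ _ _ a) => //.
- exact: measurableI.
- transitivity (leb (S `\` W) + leb (S `&` W))%E; first by rewrite SW add0e.
  by rewrite -ST; apply/esym; exact: measureDI.
Qed.

Theorem theorem3p3 (R : realType) (S : set (lebesgueR R)) (mS : measurable S)
    (T D xi : R) (T_gt0 : 0 < T) (ST : leb S = T%:E)
    (SD : diam_ess mS = D%:E) (xiD : `|xi| * D <= 1) :
  `|fourier (cindic S) xi|
     <= (if xi == 0 then T else sin (pi * `|xi| * T) / (pi * `|xi|))%:C
  /\ `|fourier (cindic S) xi| <= fourier (cindic `[- (T / 2), T / 2]) xi.
Proof.
have le := normc_fourier_le ST SD xiD.
by split=> //; rewrite fourier_itv.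
Qed.
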